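(* Thompson's group $V$ admits a faithful veelike action on the regular language $L = \epsilon + (0 + 1)^*1 \subset \{0,1\}^*$, i.e. the set consisting of the empty word and all finite binary words whose last letter is $1$.
   Context: $A^*$ is the set of finite words over a finite alphabet $A$, including the empty word $\epsilon$; $|u|$ is the length of $u$. Thompson's group $V$ is the group (under composition) of homeomorphisms $f : \{0,1\}^{\mathbb N} \to \{0,1\}^{\mathbb N}$ such that for some $n \in \mathbb N$ there exists a function $F : \{0,1\}^n \to \{0,1\}^*$ such that $f(ux) = F(u)x$ for all $u \in \{0,1\}^n$, $x \in \{0,1\}^{\mathbb N}$. Veelike action: let $L \subset A^*$ be a language and $G$ a group. An action of $G$ on the set $L$ is veelike if for all $g \in G$ there exists $n \in \mathbb N$ such that for all $u \in A^*$ with $|u| = n$ there exists $u' \in A^*$ such that $g\cdot(uv) = u'v$ for all $v \in A^*$ with $uv \in L$. *)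

(* Defs.v *)
From HB Require Import structures.
From mathcomp Require Import all_boot.
From mathcomp Require Import boolp classical_sets functions topology cantor.

Set Implicit Arguments.
Unset Strict Implicit.
Unset Printing Implicit Defensive.

Local Open Scope classical_set_scope.

Definition prepend (u : seq bool) (x : cantor_space) : cantor_space :=
  fun i => if i < size u then nth false u i else x (i - size u).

Definition homeomorphism (T U : topologicalType) (f : T -> U) : Prop :=
  continuous f /\
  exists g : U -> T, [/\ continuous g, cancel f g & cancel g f].

Definition prefix_replacing (f : cantor_space -> cantor_space) : Prop :=
  exists (n : nat) (F : n.-tuple bool -> seq bool),
    forall (u : n.-tuple bool) (x : cantor_space),
      f (prepend u x) = prepend (F u) x.

Definition in_thompson (f : cantor_space -> cantor_space) : Prop :=
  homeomorphism f /\ prefix_replacing f.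

Record thompsonV :=
  ThompsonV { thompson_fun :> cantor_space -> cantor_space;
              _ : `[< in_thompson thompson_fun >] }.

HB.instance Definition _ := [isSub for thompson_fun].
HB.instance Definition _ := [Equality of thompsonV by <:].
HB.instance Definition _ := [Choice of thompsonV by <:].

Lemma thompsonP (f : thompsonV) : in_thompson f.
Proof. by apply/asboolP; case: f. Qed.

Lemma thompson_eqP (f g : thompsonV) : (forall x, f x = g x) -> f = g.
Proof. by move=> fg; apply: val_inj; apply: funext. Qed.

Lemma prepend_cat u v x : prepend (u ++ v) x = prepend u (prepend v x).
Proof.
apply: funext => i; rewrite /prepend size_cat nth_cat.
case: ltnP => [ltn|len].
  by case: ltnP => // iu; rewrite ltn_subLR // ltn.
by rewrite ltnNge (leq_trans (leq_addr _ _) len) /= ltnNge leq_subRL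
   ?(leq_trans (leq_addr _ _) len) // len /= subnDA.
Qed.

Lemma prepend_split n (x : cantor_space) :
  x = prepend (mkseq x n) (fun i => x (n + i)).
Proof.
apply: funext => i; rewrite /prepend size_mkseq.
by case: ltnP => [lt_in|le_ni]; [rewrite nth_mkseq | rewrite subnKC].
Qed.

Lemma prepend_inj u : injective (prepend u).
Proof.
move=> x y /(congr1 (fun z : cantor_space => fun i => z (size u + i))) xy.
apply: funext => i; have := congr1 (@^~ i) xy.
by rewrite /prepend ltnNge leq_addr /= addKn.
Qed.

Lemma prepend_prefix u v x y : size u <= size v ->
  prepend u x = prepend v y -> exists w, v = u ++ w.
Proof.
move=> uv e; exists (drop (size u) v); rewrite -{1}(cat_take_drop (size u) v).
congr (_ ++ _); apply: (@eq_from_nth _ false) => [|i]; rewrite size_takel //.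
move=> iu; rewrite nth_take //; have := congr1 (@^~ i) e.
by rewrite /prepend iu (leq_trans iu uv).
Qed.

Lemma prefix_replacingW f : prefix_replacing f -> exists n, forall m, n <= m ->
  exists F : seq bool -> seq bool, forall u, size u = m ->
    m - n <= size (F u) /\ forall x, f (prepend u x) = prepend (F u) x.
Proof.
case=> n [F fF]; exists n => m le_nm.
exists (fun u => odflt [::] (omap F (insub (take n u))) ++ drop n u) => u um.
split=> [|x]; first by rewrite size_cat size_drop um leq_addl.
have tu : size (take n u) == n by rewrite size_takel // um.
by rewrite insubT /= -{1}(cat_take_drop n u) !prepend_cat (fF (Tuple tu)).
Qed.

Lemma prefix_replacing_seq f n (F : seq bool -> seq bool) :
  (forall u, size u = n -> forall x, f (prepend u x) = prepend (F u) x) ->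
  prefix_replacing f.
Proof.
by move=> fF; exists n, (fun u => F u) => u x; rewrite fF // size_tuple.
Qed.

Lemma in_thompson_id : in_thompson id.
Proof.
split; last by exists 0, (fun u => u).
by split; [move=> x; exact: cvg_id | exists id; split => // x; exact: cvg_id].
Qed.

Lemma in_thompson_comp f g :
  in_thompson f -> in_thompson g -> in_thompson (f \o g).
Proof.
case=> [[cf [f' [cf' fK f'K]]] /prefix_replacingW[n Pf]].
case=> [[cg [g' [cg' gK g'K]]] /prefix_replacingW[m Pg]]; split.
  split; first by move=> x; apply: continuous_comp; [exact: cg | exact: cf].
  exists (g' \o f'); split.
  - by move=> x; apply: continuous_comp; [exact: cf' | exact: cg'].
  - exact: can_comp.
  - exact: can_comp.
have [G GP] := Pg (m + n) (leq_addr _ _).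
have HF (k : nat) : exists F : seq bool -> seq bool, n <= k ->
    forall u, size u = k -> forall x, f (prepend u x) = prepend (F u) x.
  case: (leqP n k) => [/Pf[F FP]|_]; last by exists id.
  by exists F => _ u uk; have [] := FP u uk.
have [F FP] := choice HF.
apply: (@prefix_replacing_seq _ (m + n) (fun u => F (size (G u)) (G u))).
move=> u um x; have [szG gG] := GP u um; rewrite addnC addnK in szG.
by rewrite /= gG (FP _ szG).
Qed.

Lemma in_thompson_inv f g : in_thompson f -> continuous g ->
  cancel f g -> cancel g f -> in_thompson g.
Proof.
move=> [[cf _] [n [F fF]]] cg fK gK; split; first by split=> //; exists f.
pose N := \max_(u : n.-tuple bool) size (F u).
have HG (w : seq bool) : exists w', size w = N ->
    forall x, g (prepend w x) = prepend w' x.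
  case: (eqVneq (size w) N) => [wN|/eqP wN]; last by exists [::].
  pose y := g (prepend w (fun=> false)).
  have sz : size (mkseq y n) == n by rewrite size_mkseq.
  pose u := Tuple sz.
  have yE : y = prepend u (fun i => y (n + i)) by exact: prepend_split.
  have e : prepend (F u) (fun i => y (n + i)) = prepend w (fun=> false).
    by rewrite -fF -yE /y gK.
  have /prepend_prefix-/(_ _ _ e)[v wE] : size (F u) <= size w.
    by rewrite wN /N; exact: leq_bigmax.
  exists (u ++ v) => _ x; apply: (can_inj fK).
  by rewrite gK prepend_cat fF -prepend_cat -wE.
have [G GP] := choice HG.
exact: (@prefix_replacing_seq _ N G).
Qed.

Lemma thompson_inv_subproof (f : thompsonV) :
  exists g : thompsonV, cancel f g /\ cancel g f.
Proof.
have tf := thompsonP f; have [[_ [g [cg fK gK]]] _] := tf.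
have tg : `[< in_thompson g >] by apply/asboolP; exact: (in_thompson_inv tf).
by exists (ThompsonV tg).
Qed.

Definition thompson_one : thompsonV := ThompsonV (asboolT in_thompson_id).
Definition thompson_mul (f g : thompsonV) : thompsonV :=
  ThompsonV (asboolT (in_thompson_comp (thompsonP f) (thompsonP g))).
Definition thompson_inv (f : thompsonV) : thompsonV :=
  projT1 (cid (thompson_inv_subproof f)).

Fact thompson_mulA : associative thompson_mul.
Proof. by move=> f g h; apply: thompson_eqP. Qed.
Fact thompson_mul1 : left_id thompson_one thompson_mul.
Proof. by move=> f; apply: thompson_eqP. Qed.
Fact thompson_mulr1 : right_id thompson_one thompson_mul.
Proof. by move=> f; apply: thompson_eqP. Qed.
Fact thompson_mulV : left_inverse thompson_one thompson_inv thompson_mul.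
Proof.
move=> f; apply: thompson_eqP => x /=.
by rewrite /thompson_inv; case: cid => g [].
Qed.
Fact thompson_mulrV : right_inverse thompson_one thompson_inv thompson_mul.
Proof.
move=> f; apply: thompson_eqP => x /=.
by rewrite /thompson_inv; case: cid => g [].
Qed.

HB.instance Definition _ := isGroup.Build thompsonV thompson_mulA
  thompson_mul1 thompson_mulr1 thompson_mulV thompson_mulrV.

Section Actions.
Local Open Scope group_scope.

Definition is_group_action (G : groupType) (T : Type) (act : G -> T -> T) :=
  (forall x, act 1 x = x) /\
  (forall g h x, act (g * h) x = act g (act h x)).

Definition faithful_action (G : groupType) (T : Type) (act : G -> T -> T) :=
  forall g, (forall x, act g x = x) -> g = 1.

End Actions.

(* [w : L] with [val w = u ++ v] encodes that [u ++ v] belongs to [L]; note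
   that [u'] is chosen before [v]. *)
Definition veelike (A : finType) (L : set (seq A)) (G : groupType)
    (act : G -> L -> L) : Prop :=
  forall g : G, exists n : nat, forall u : seq A, size u = n ->
    exists u' : seq A, forall (v : seq A) (w : L),
      val w = u ++ v -> val (act g w) = u' ++ v.

Inductive regexp (A : Type) : Type :=
| RVoid
| REps
| RAtom of A
| RPlus of regexp A & regexp A
| RConc of regexp A & regexp A
| RStar of regexp A.
Arguments RVoid {A}.
Arguments REps {A}.

Inductive kleene_star (A : Type) (L : set (seq A)) : set (seq A) :=
| kleene_nil : kleene_star L [::]
| kleene_cat u v : L u -> kleene_star L v -> kleene_star L (u ++ v).

Fixpoint lang (A : Type) (r : regexp A) : set (seq A) :=
  match r with
  | RVoid => set0
  | REps => [set [::]]
  | RAtom a => [set [:: a]]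
  | RPlus r1 r2 => lang r1 `|` lang r2
  | RConc r1 r2 => [set u ++ v | u in lang r1 & v in lang r2]
  | RStar r1 => kleene_star (lang r1)
  end.

(* epsilon + (0 + 1)^* 1, with 0 and 1 encoded as [false] and [true]; it is
   regular because it is given by a regular expression *)
Definition lang_last1 : set (seq bool) :=
  lang (RPlus REps (RConc (RStar (RPlus (RAtom false) (RAtom true)))
                          (RAtom true))).

Lemma lang_last1E :
  lang_last1 = [set w | w = [::] \/ exists v, w = rcons v true].
Proof.
apply/seteqP; split=> w /= [-> |]; try by left.
  by case=> u _ [_ -> <-]; right; exists u; rewrite cats1.
case=> v ->; right; exists v; last by exists [:: true] => //; rewrite cats1.
elim: v => [|a v IHv]; first exact: kleene_nil.
rewrite -cat1s; apply: kleene_cat => //=.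
by case: a; [right | left].
Qed.

(* Main.v *)
Require Import Defs.
From mathcomp Require Import all_boot classical_sets.
From mathcomp Require Import boolp cantor.

(** A word [w] of the language is identified with the infinite sequence
    [w 0 0 0 ...].  Deleting trailing zeros shows that this is a bijection from
    the language onto the eventually zero sequences ([zero_ext_surj] and
    [zero_ext_inj]), and a prefix-replacing map preserves the latter because it
    does not change tails.  Thompson's group therefore acts on the language by
    restriction.

    The action is faithful because a prefix-replacing map is determined by its
    values on the dense set of eventually zero sequences.

    For the veelike condition, let [f] replace prefixes of length [n], by the
    function [F].  Prefixes of length [n] themselves are not enough: if [F u]
    ends in 0, then the empty continuation of [u] is sent to a proper prefix of
    [F u], whereas nonempty continuations [v] are sent to [F u ++ v].  With
    prefixes of length [n.+1] the last letter of the word is always copied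
    unchanged, so that the image word still ends in 1 and no zeros have to be
    deleted. *)

Set Implicit Arguments.
Unset Strict Implicit.
Unset Printing Implicit Defensive.

Definition zeros : cantor_space := fun=> false.

Definition zero_ext (w : seq bool) : cantor_space := prepend w zeros.

(** The default value [true] of [last] accounts for the empty word. *)
Lemma lang_last1P w : lang_last1 w <-> last true w.
Proof.
rewrite lang_last1E /=; split=> [[->|[v ->]]|]; rewrite ?last_rcons //.
by case/lastP: w => [|v a]; [left | rewrite last_rcons => ->; right; exists v].
Qed.

Lemma lang_last1_last (w : lang_last1) : last true (val w).
Proof. by apply/lang_last1P; have := valP w; rewrite inE. Qed.

Lemma zero_ext_rcons0 w : zero_ext (rcons w false) = zero_ext w.
Proof.
rewrite -cats1 /zero_ext prepend_cat; congr (prepend w _).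
by apply: funext => -[|i].
Qed.

Lemma zero_ext_surj w : exists w' : lang_last1, zero_ext w = zero_ext (val w').
Proof.
have in_lang v (v1 : last true v) :
    exists w' : lang_last1, zero_ext v = zero_ext (val w').
  have vL : v \in lang_last1 by rewrite inE; apply/lang_last1P.
  by exists (exist _ v vL).
elim/last_ind: w => [|w [] IHw]; first exact: in_lang.
- by apply: in_lang; rewrite last_rcons.
- by rewrite zero_ext_rcons0.
Qed.

Lemma zero_ext_inj u v :
  last true u -> last true v -> zero_ext u = zero_ext v -> u = v.
Proof.
wlog le_uv : u v / size u <= size v => [WL | ] u1 v1 e.
  by have [/WL|/ltnW/WL vu] := leqP (size u) (size v); [exact | apply/esym/vu].
have [w vE] := prepend_prefix le_uv e; subst v.
move: e; rewrite /zero_ext prepend_cat => /prepend_inj e.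
case/lastP: w e v1 {le_uv} => [|w a]; first by rewrite cats0.
(* Reading both sides at the last position of [rcons w a] gives [a = false]. *)
move=> /(congr1 (@^~ (size w))).
by rewrite /prepend size_rcons ltnSn nth_rcons ltnn eqxx last_cat last_rcons => <-.
Qed.

Lemma lang_last1_inj (u v : lang_last1) :
  zero_ext (val u) = zero_ext (val v) -> u = v.
Proof.
by move=> e; apply: val_inj; apply: zero_ext_inj e; exact: lang_last1_last.
Qed.

Lemma prefix_replacing_zero_ext f w : prefix_replacing f ->
  exists w', f (zero_ext w) = zero_ext w'.
Proof.
case=> n [F fF].
(* Padding by [n] zeros makes sure that a prefix of length [n] exists. *)
pose p := w ++ nseq n false.
have -> : zero_ext w = zero_ext p.
  rewrite /zero_ext prepend_cat; congr (prepend w _).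
  by apply: funext => i; rewrite /prepend nth_nseq !if_same.
have sz : size (take n p) == n.
  by rewrite size_takel // size_cat size_nseq leq_addl.
exists (F (Tuple sz) ++ drop n p).
by rewrite /zero_ext -{1}(cat_take_drop n p) !prepend_cat (fF (Tuple sz)).
Qed.

Lemma prepend_local u x y i :
  (forall j, j <= i -> x j = y j) -> prepend u x i = prepend u y i.
Proof. by move=> xy; rewrite /prepend; case: ifP => // _; rewrite xy ?leq_subr. Qed.

(** The letter at position [i] of [f (u x)] depends only on [u] and the first
    [i.+1] letters of [x], so [x] can be replaced by an eventually zero
    sequence. *)
Lemma prefix_replacing_fix f : prefix_replacing f ->
  (forall w, f (zero_ext w) = zero_ext w) -> forall x, f x = x.
Proof.
move=> [n [F fF]] fix0 x; apply: funext => i.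
have sz : size (mkseq x n) == n by rewrite size_mkseq.
rewrite (prepend_split n x); set y := (fun i => _).
have yE j : j <= i -> y j = zero_ext (mkseq y i.+1) j.
  by move=> le_ji; rewrite /zero_ext /prepend size_mkseq ltnS le_ji nth_mkseq.
rewrite (fF (Tuple sz)) (prepend_local _ yE) -fF -prepend_cat.
rewrite [f _]fix0 /zero_ext prepend_cat.
by rewrite -(prepend_local _ yE).
Qed.

(** The witness is one more than the number of letters that [f] reads: the last
    of these [n.+1] letters then belongs to the unchanged tail. *)
Lemma prefix_replacing_last f : prefix_replacing f ->
  exists n, forall u, size u = n -> exists2 u', last true u' = last true u &
    forall x, f (prepend u x) = prepend u' x.
Proof.
case=> n [F fF]; exists n.+1 => u; case/lastP: u => // u a.
rewrite size_rcons => -[/eqP sz]; exists (rcons (F (Tuple sz)) a).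
  by rewrite !last_rcons.
by move=> x; rewrite -!cats1 !prepend_cat (fF (Tuple sz)).
Qed.

Theorem theorem4 :
  exists act : thompsonV -> lang_last1 -> lang_last1,
    [/\ is_group_action act, faithful_action act & veelike act].
Proof.
have actP (fw : thompsonV * lang_last1) : exists w' : lang_last1,
    fw.1 (zero_ext (val fw.2)) = zero_ext (val w').
  have [_ /prefix_replacing_zero_ext-/(_ (val fw.2))[w ->]] := thompsonP fw.1.
  exact: zero_ext_surj.
have [act' act'E] := choice actP.
pose act f w := act' (f, w).
have actE f w : zero_ext (val (act f w)) = f (zero_ext (val w)).
  by rewrite /act -act'E.
exists act; split.
- split=> [w | f g w]; apply: lang_last1_inj; first by rewrite actE.
  by rewrite !actE.
- move=> f fix_f; apply: thompson_eqP; have [_ rf] := thompsonP f.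
  apply: (prefix_replacing_fix rf) => w.
  by have [w' ->] := zero_ext_surj w; rewrite -actE fix_f.
- move=> f; have [_ /prefix_replacing_last[n fP]] := thompsonP f.
  exists n => u /fP[u' lu' fu]; exists u' => v w wE.
  apply: zero_ext_inj; first exact: lang_last1_last.
    by rewrite last_cat lu' -last_cat -wE lang_last1_last.
  by rewrite actE wE /zero_ext !prepend_cat fu.
Qed.
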